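(* Let $n\ge 1$, let $P\subseteq[0,1]^n$ be a convex set with $\mathbf{0}\in P$, and let $F:[0,1]^n\to\mathbb{R}_{\ge 0}$ be a non-negative, differentiable, DR-submodular function with $F(\mathbf{0})=0$ that is $L$-smooth on $P$, i.e. $\|\nabla F(x)-\nabla F(y)\|\le L\|x-y\|$ for all $x,y\in P$. Let $x^*\in\arg\max_{x\in P}F(x)$. For an integer $T\ge 1$, run Algorithm FW-Dis (described in the context) for $T$ iterations. Then the point $x(t_T)$ satisfies \[ F(x(t_T))\ \ge\ \frac14 F(x^* )-O\!\left(\frac{nL}{\ln^2 T}\right), \] where the constant hidden in the $O(\cdot)$ is absolute (independent of $n$, $L$, $T$, $F$, $P$). Consequently, for any $\varepsilon>0$, $F(x(t_T))\ge \frac14 F(x^* )-\varepsilon$ after $T=O\!\left(e^{\sqrt{nL/\varepsilon}}\right)$ iterations.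
   Context: DR-submodularity: for all $x\le y$ in $[0,1]^n$ (coordinatewise), all $i\in\{1,\dots,n\}$ and all $a>0$ with $x+ae_i,\,y+ae_i\in[0,1]^n$, one has $F(x+ae_i)-F(x)\ge F(y+ae_i)-F(y)$; for differentiable $F$ this is equivalent to $\nabla F(x)\ge\nabla F(y)$ whenever $x\le y$. The algorithm has access to oracles computing $F(x)$, $\nabla F(x)$, and a maximizer of a linear function over $P$. Harmonic numbers: $H_0=0$, $H_j=\sum_{k=1}^j 1/k$. Algorithm FW-Dis$(F,P,T)$: set $x(t_0)=\mathbf{0}$. For $j=0,1,\dots,T$ define $t_j=\frac{1}{1-\ln\left(1+H_j/H_T\right)}-1$ (so $t_0=0$ and $e^{t_j/(1+t_j)}=1+H_j/H_T$). For $j=0,1,\dots,T-1$: choose $v(x(t_j))\in\arg\max_{v\in P}\langle\nabla F(x(t_j)),v\rangle$ and set \[ x(t_{j+1})=e^{-\frac{1}{1+t_j}+\frac{1}{1+t_{j+1}}}\,x(t_j)+\Bigl(1-e^{-\frac{1}{1+t_j}+\frac{1}{1+t_{j+1}}}\Bigr)v(x(t_j)). \] (The algorithm returns a point of maximum $F$-value among the iterates $x(t_j)$.) *)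

(* Defs.v *)
From HB Require Import structures.
From mathcomp Require Import all_boot all_order all_algebra.
From mathcomp Require Import all_classical all_reals all_analysis.

Set Implicit Arguments.
Unset Strict Implicit.
Unset Printing Implicit Defensive.

Import Order.TTheory GRing.Theory Num.Theory.
Import numFieldNormedType.Exports.

Local Open Scope classical_set_scope.
Local Open Scope ring_scope.

Section FrankWolfe.
Variables (R : realType) (n : nat).
Implicit Types (x y v g : 'rV[R]_n) (P : set 'rV[R]_n) (F : 'rV[R]_n -> R)
  (gradF : 'rV[R]_n -> 'rV[R]_n) (L : R) (T j : nat).

Definition cube : set 'rV[R]_n := [set x | forall i, 0 <= x 0 i <= 1].

Definition dotv x y : R := \sum_i x 0 i * y 0 i.

(* The library norm `|x| on 'rV[R]_n is the sup norm, hence this definition. *)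
Definition norm2 x : R := Num.sqrt (dotv x x).

Definition DR_submodular F : Prop :=
  forall x y, (forall i, x 0 i <= y 0 i) ->
  forall (i : 'I_n) (a : R), 0 < a ->
    cube x -> cube y ->
    cube (x + a *: delta_mx 0 i) -> cube (y + a *: delta_mx 0 i) ->
    F (x + a *: delta_mx 0 i) - F x >= F (y + a *: delta_mx 0 i) - F y.

(* F is a function on the cube, so the limit is taken along points of the cube
   only; this determines g, at boundary points such as 0 as well. Values of F
   outside the cube are irrelevant. *)
Definition is_gradient F x g : Prop :=
  (F y - F x - dotv g (y - x)) / norm2 (y - x) @[y --> within cube x^'] --> 0.

Definition gradient_on_cube F gradF : Prop :=
  forall x, cube x -> is_gradient F x (gradF x).

Definition smooth_on P gradF L : Prop :=
  forall x y, P x -> P y ->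
    norm2 (gradF x - gradF y) <= L * norm2 (x - y).

Definition is_argmax P (f : 'rV[R]_n -> R) x : Prop :=
  P x /\ forall y, P y -> f y <= f x.

Definition harmonic_number j : R := \sum_(1 <= k < j.+1) k%:R^-1.

Definition fw_time T j : R := (1 - ln (1 + harmonic_number j / harmonic_number T))^-1 - 1.

Definition fw_decay T j : R :=
  expR (- (1 + fw_time T j)^-1 + (1 + fw_time T j.+1)^-1).

(* x j is the iterate x(t_j); the linear oracle may return any maximizer. *)
Definition FW_Dis_run gradF P T (x : nat -> 'rV[R]_n) : Prop :=
  x 0%N = 0 /\
  forall j, (j < T)%N ->
    exists2 v, is_argmax P (dotv (gradF (x j))) v &
      x j.+1 = fw_decay T j *: x j + (1 - fw_decay T j) *: v.

End FrankWolfe.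

(* Main.v *)
Require Import Defs.
From mathcomp Require Import all_boot all_order all_algebra.
From mathcomp Require Import all_classical all_reals all_analysis.
From mathcomp Require Import ring lra.

Set Implicit Arguments.
Unset Strict Implicit.
Unset Printing Implicit Defensive.

Import Order.TTheory GRing.Theory Num.Theory.
Import numFieldNormedType.Exports.

Local Open Scope classical_set_scope.
Local Open Scope ring_scope.

(* Let a_j = 1 + H_j / H_T, so that a_0 = 1, a_T = 2 and the decay factor of
   step j is a_j / a_{j+1}. A DR-submodular F is concave along segments whose
   direction has coordinates of constant sign. This gives the gradient inequality
   <grad F x, y - x> >= F (x \/ y) + F (x /\ y) - 2 F x and, as the coordinates of
   x_j are at most 1 - 1 / a_j, also F (x_j \/ y) >= F y / a_j. Hence the
   Frank-Wolfe gap at x_j is at least max (0, F y / a_j - 2 F x_j) for every y in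
   P, and by smoothness a_j^2 F x_j - a_j F y decreases by at most
   n L (a_{j+1} - a_j)^2 / 2 in step j. These losses add up to at most
   n L / H_T^2 <= n L / ln^2 T. *)

Section DotProduct.
Variables (R : realType) (n : nat).
Implicit Types (x y z : 'rV[R]_n) (a : R).

Lemma dotvC x y : dotv x y = dotv y x.
Proof. by apply: eq_bigr => i _; rewrite mulrC. Qed.

Lemma dotvDr x y z : dotv x (y + z) = dotv x y + dotv x z.
Proof. by rewrite /dotv -big_split; apply: eq_bigr => i _; rewrite mxE mulrDr. Qed.

Lemma dotvZr a x y : dotv x (a *: y) = a * dotv x y.
Proof. by rewrite /dotv mulr_sumr; apply: eq_bigr => i _; rewrite mxE mulrCA. Qed.

Lemma dotv0r x : dotv x 0 = 0.
Proof. by rewrite -(scale0r 0) dotvZr mul0r. Qed.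

Lemma dotvBr x y z : dotv x (y - z) = dotv x y - dotv x z.
Proof. by rewrite -scaleN1r dotvDr dotvZr mulN1r. Qed.

Lemma dotvBl x y z : dotv (x - y) z = dotv x z - dotv y z.
Proof. by rewrite dotvC dotvBr !(dotvC z). Qed.

Lemma dotvZl a x y : dotv (a *: x) y = a * dotv x y.
Proof. by rewrite dotvC dotvZr dotvC. Qed.

Lemma dotvv_ge0 x : 0 <= dotv x x.
Proof. by apply: sumr_ge0 => i _; rewrite -expr2 sqr_ge0. Qed.

Lemma dotvv_eq0 x : (dotv x x == 0) = (x == 0).
Proof.
apply/eqP/eqP => [xx0|->]; last by rewrite dotv0r.
apply/rowP => i; rewrite mxE.
have /psumr_eq0P/(_ xx0 i isT)/eqP : forall j, true -> 0 <= x 0 j * x 0 j.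
  by move=> j _; rewrite -expr2 sqr_ge0.
by rewrite mulf_eq0 orbb => /eqP.
Qed.

Lemma norm2_ge0 x : 0 <= norm2 x.
Proof. exact: sqrtr_ge0. Qed.

Lemma norm2_gt0 x : (0 < norm2 x) = (x != 0).
Proof. by rewrite sqrtr_gt0 lt0r dotvv_eq0 dotvv_ge0 andbT. Qed.

Lemma sqr_norm2 x : norm2 x ^+ 2 = dotv x x.
Proof. by rewrite sqr_sqrtr ?dotvv_ge0. Qed.

Lemma norm2Z a x : norm2 (a *: x) = `|a| * norm2 x.
Proof.
by rewrite /norm2 dotvZl dotvZr mulrA -expr2 sqrtrM ?sqr_ge0 ?sqrtr_sqr.
Qed.

Lemma CauchySchwarz_norm2 x y : `|dotv x y| <= norm2 x * norm2 y.
Proof.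
have [->|y_neq0] := eqVneq y 0.
  by rewrite dotv0r normr0 mulr_ge0 ?norm2_ge0.
rewrite -ler_sqr ?nnegrE ?mulr_ge0 ?norm2_ge0 // exprMn !sqr_norm2.
rewrite real_normK ?num_real //.
have yy_gt0 : 0 < dotv y y by rewrite -sqr_norm2 exprn_gt0 ?norm2_gt0.
rewrite -subr_ge0 -(pmulr_rge0 _ yy_gt0).
have := dotvv_ge0 (dotv y y *: x - dotv x y *: y).
rewrite dotvBl !dotvBr !dotvZl !dotvZr (dotvC y x).
by congr (0 <= _); ring.
Qed.

End DotProduct.

Lemma within_id T (F : set_system T) (A : set T) : Filter F -> F A -> within A F = F.
Proof.
move=> FF FA; apply/seteqP; split=> U; last by apply: filterS => x Ux _.
by apply: filterS2 FA => x Ax; apply.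
Qed.

Lemma cvg_to_within T U (f : T -> U) (F : set_system T) (G : set_system U)
    (A : set U) : Filter F ->
  f @ F `=>` G -> (\forall x \near F, A (f x)) -> f @ F `=>` within A G.
Proof.
by move=> FF fG fA V GV; apply: filterS2 fA (fG _ GV) => x Ax; apply.
Qed.

Section DeriveWithin.
Variable R : realType.
Implicit Types (A B : set R) (f : R -> R) (t D : R).

(* A gradient relative to the cube only yields one-sided derivatives at the end
   points of a segment. *)
Definition is_derive_within A f t D : Prop :=
  (f s - f t) / (s - t) @[s --> within A t^'] --> D.

Lemma is_derive_withinS A B f t D : A `<=` B ->
  is_derive_within B f t D -> is_derive_within A f t D.
Proof. by move=> AB; apply: cvg_trans; apply: cvg_fmap2; apply: within_subset. Qed.

Lemma is_derive_within_interior A f t D : A° t ->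
  is_derive_within A f t D -> is_derive t 1 f D.
Proof.
move=> At; rewrite /is_derive_within within_id; last exact: nbhs_dnbhs.
move=> fD; apply/is_derive1_caratheodory.
exists (fun s => if s == t then D else (f s - f t) / (s - t)); split.
- move=> s; have [->|s_neq_t] := eqVneq s t; first by rewrite !subrr mulr0.
  by rewrite divfK ?subr_eq0.
- apply/continuous_withinNx; rewrite eqxx; apply: cvg_trans fD.
  apply: near_eq_cvg; near=> s; rewrite ifN //.
  near: s; exact: nbhs_dnbhs_neq.
- by rewrite eqxx.
Unshelve. all: by end_near. Qed.

Lemma is_derive_within_continuous A f t D :
  is_derive_within A f t D -> f @ within A (nbhs t) --> f t.
Proof.
move=> fD.
have ft : (f s - f t) / (s - t) * (s - t) + f t @[s --> within A t^'] --> f t.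
  rewrite -[X in _ --> X]add0r -(mulr0 D) -(subrr t).
  apply: cvgD; [apply: cvgM fD _|exact: cvg_cst].
  apply: cvgB; last exact: cvg_cst.
  by apply: cvg_within_filter; exact: nbhs_dnbhs.
move=> U Ut.
have Unear : \forall s \near t, s != t -> A s ->
    U ((f s - f t) / (s - t) * (s - t) + f t).
  exact: ft.
apply: filterS Unear => s Us As; have [->|s_neq_t] := eqVneq s t.
  exact: nbhs_singleton Ut.
by have := Us s_neq_t As; rewrite divfK ?subrK ?subr_eq0.
Qed.

Lemma is_derive_within_quadratic_ge f (df : R -> R) (u v a b : R) : u < v ->
  (forall t, t \in `[u, v] -> is_derive_within `[u, v] f t (df t)) ->
  (forall t, t \in `]u, v[ -> a - b * (t - u) <= df t) ->
  f u + a * (v - u) - b / 2 * (v - u) ^+ 2 <= f v.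
Proof.
move=> uv f_derive df_ge.
pose q t : R := b / 2 * (t - u) ^+ 2 - a * (t - u).
have q_derive t : is_derive t 1 q (b * (t - u) - a).
  by apply: is_derive_eq; rewrite /= /GRing.scale /=; field.
have [t t_uv||c c_uv] := @MVT R (f \+ q) (fun t => df t + (b * (t - u) - a)) u v uv.
- apply: is_deriveD; apply: is_derive_within_interior (f_derive t _).
    by rewrite interior_itv.
  exact: subset_itv_oo_cc.
- apply: within_continuousD.
    by apply/subspace_continuousP => t /f_derive; exact: is_derive_within_continuous.
  apply: continuous_subspaceT => t.
  exact/differentiable_continuous/derivable1_diffP.
- have slope_ge0 : 0 <= (df c + (b * (c - u) - a)) * (v - u).
    by rewrite mulr_ge0 ?subr_ge0 ?(ltW uv) //; have := df_ge c c_uv; lra.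
  by move=> increment; move: slope_ge0; rewrite -increment /= /q; lra.
Qed.

(* Cutting [0, 1] into k equal pieces bounds f 1 - f 0 by k (f (1 / k) - f 0),
   which tends to D. *)
Lemma subadditive_increment_le_derive f D :
  (forall u s, 0 <= u -> 0 <= s -> u + s <= 1 ->
    f (u + s) - f u <= f s - f 0) ->
  is_derive_within `[0, 1] f 0 D -> f 1 - f 0 <= D.
Proof.
move=> f_incr fD.
have f_natmul m s : 0 <= s -> m%:R * s <= 1 ->
    f (m%:R * s) - f 0 <= m%:R * (f s - f 0).
  move=> s_ge0; elim: m => [|m IH] ms_le1; first by rewrite !mul0r subrr.
  move: ms_le1; rewrite -natr1 !mulrDl !mul1r => ms_le1.
  have ms_ge0 : 0 <= m%:R * s by rewrite mulr_ge0.
  have := f_incr _ _ ms_ge0 s_ge0 ms_le1.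
  by have := IH (le_trans _ ms_le1); rewrite lerDl => /(_ s_ge0); lra.
have harmonic_near : harmonic @ \oo --> within `[0, 1] (0 : R)^'.
  apply: cvg_to_within; first apply: cvg_to_within cvg_harmonic _.
    by near=> k; rewrite gt_eqF ?harmonic_gt0.
  by near=> k; rewrite /= in_itv /= harmonic_ge0 invf_le1 ?ler1n.
have quotient_cvg := cvg_comp _ _ harmonic_near fD.
apply: cvgr_to_ge quotient_cvg _; near=> k.
rewrite /= subr0 invrK mulrC.
have := f_natmul k.+1 (harmonic k) (harmonic_ge0 k).
by rewrite mulfV ?pnatr_eq0 //; apply.
Unshelve. all: by end_near. Qed.

End DeriveWithin.

Lemma convex_set_segment (R : numDomainType) (V : lmodType R) (A : set V)
    (x d : V) (t : R) :
  convex_set A -> A x -> A (x + d) -> 0 <= t <= 1 -> A (x + t *: d).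
Proof.
move=> cA Ax Axd /andP[t_ge0 t_le1].
have := cA (x + d) x (Itv01 t_ge0 t_le1); rewrite !inE => /(_ Axd Ax).
by congr A; rewrite /conv /= scalerDr addrAC -scalerDl subrKC scale1r.
Qed.

Lemma lineB (R : pzRingType) (V : lmodType R) (x d : V) (s t : R) :
  x + s *: d - (x + t *: d) = (s - t) *: d.
Proof. by rewrite opprD addrACA subrr add0r scalerBl. Qed.

Lemma cvg_line_dnbhs (R : numFieldType) (V : normedModType R) (x d : V) (t : R) :
  d != 0 -> x + s *: d @[s --> t^'] --> (x + t *: d)^'.
Proof.
move=> d_neq0; apply: cvg_to_within.
  apply: cvg_within_filter; apply: cvgD; first exact: cvg_cst.
  exact: scalel_continuous.
near=> s; rewrite -subr_eq0 /= lineB scaler_eq0 negb_or d_neq0 andbT subr_eq0.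
by near: s; exact: nbhs_dnbhs_neq.
Unshelve. all: by end_near. Qed.

Section CoordinatewiseOrder.
Variables (R : realDomainType) (n : nat).
Implicit Types (x y z d : 'rV[R]_n) (a : R) (k : nat).

Definition lerv x y : Prop := forall i, x 0 i <= y 0 i.

Lemma lerv_trans x y z : lerv x y -> lerv y z -> lerv x z.
Proof. by move=> xy yz i; exact: le_trans (xy i) (yz i). Qed.

Lemma lerv_add2r z x y : lerv x y -> lerv (x + z) (y + z).
Proof. by move=> xy i; rewrite !mxE lerD2r. Qed.

Lemma lerv_add2l z x y : lerv x y -> lerv (z + x) (z + y).
Proof. by move=> xy i; rewrite !mxE lerD2l. Qed.

Lemma lervDl x d : lerv 0 d -> lerv x (x + d).
Proof. by move=> d_ge0 i; have := d_ge0 i; rewrite !mxE lerDl. Qed.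

Lemma oppv_ge0 d : lerv d 0 -> lerv 0 (- d).
Proof. by move=> d_le0 i; have := d_le0 i; rewrite !mxE oppr_ge0. Qed.

Lemma scalev_ge0 a d : 0 <= a -> lerv 0 d -> lerv 0 (a *: d).
Proof. by move=> a_ge0 d_ge0 i; have := d_ge0 i; rewrite !mxE; exact: mulr_ge0. Qed.

Definition same_sign d : Prop := lerv 0 d \/ lerv d 0.

Lemma same_signZ a d : same_sign d -> same_sign (a *: d).
Proof.
have [a_ge0|/ltW a_le0] := leP 0 a; case=> d_sign; [left|right|right|left] => i;
  by have := d_sign i; rewrite !mxE; nra.
Qed.

Definition joinv x y : 'rV[R]_n := \row_i Num.max (x 0 i) (y 0 i).

Definition meetv x y : 'rV[R]_n := \row_i Num.min (x 0 i) (y 0 i).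

Lemma joinv_addr_meetv x y : joinv x y + meetv x y = x + y.
Proof. by apply/rowP => i; rewrite !mxE addr_max_min. Qed.

Lemma lerv_joinl x y : lerv x (joinv x y).
Proof. by move=> i; rewrite mxE le_max lexx. Qed.

Lemma lerv_joinr x y : lerv y (joinv x y).
Proof. by move=> i; rewrite mxE le_max lexx orbT. Qed.

Lemma lerv_meetl x y : lerv (meetv x y) x.
Proof. by move=> i; rewrite mxE ge_min lexx. Qed.

Definition prefixv k d : 'rV[R]_n := \row_i (if (i < k)%N then d 0 i else 0).

Lemma prefixv0 d : prefixv 0 d = 0.
Proof. by apply/rowP => i; rewrite !mxE. Qed.

Lemma prefixv_id d : prefixv n d = d.
Proof. by apply/rowP => i; rewrite mxE ltn_ord. Qed.

Lemma prefixvS (i : 'I_n) d :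
  prefixv i.+1 d = prefixv i d + d 0 i *: delta_mx 0 i.
Proof.
apply/rowP => j; rewrite !mxE ltnS leq_eqVlt val_eqE.
by have [->|] := eqVneq j i; rewrite /= ?ltnn ?add0r ?mulr1 ?mulr0 ?addr0.
Qed.

Lemma prefixv_ge0 k d : lerv 0 d -> lerv 0 (prefixv k d).
Proof. by move=> d_ge0 i; have := d_ge0 i; rewrite !mxE; case: ifP. Qed.

Lemma prefixv_le k d : lerv 0 d -> lerv (prefixv k d) d.
Proof. by move=> d_ge0 i; have := d_ge0 i; rewrite !mxE; case: ifP. Qed.

End CoordinatewiseOrder.

Section UnitCube.
Variables (R : realType) (n : nat).
Implicit Types (x y z d g : 'rV[R]_n) (F : 'rV[R]_n -> R) (t : R).

Lemma cube_joinv x y : cube x -> cube y -> cube (joinv x y).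
Proof. by move=> cx cy i; rewrite mxE /Num.max; case: ifP. Qed.

Lemma cube_meetv x y : cube x -> cube y -> cube (meetv x y).
Proof. by move=> cx cy i; rewrite mxE /Num.min; case: ifP. Qed.

Lemma cube_between x y z : cube x -> cube z -> lerv x y -> lerv y z -> cube y.
Proof.
move=> cx cz xy yz i; have /andP[x_ge0 _] := cx i; have /andP[_ z_le1] := cz i.
by rewrite (le_trans x_ge0 (xy i)) (le_trans (yz i) z_le1).
Qed.

Lemma convex_cube : convex_set (@cube R n).
Proof.
move=> x y t; rewrite !inE => cx cy i.
have /andP[x_ge0 x_le1] := cx i; have /andP[y_ge0 y_le1] := cy i.
have t_ge0 : 0 <= t%:num by []; have t_le1 : t%:num <= 1 by [].
by rewrite !mxE /unstable.onem; apply/andP; split; nra.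
Qed.

Lemma cube_segment x d t :
  cube x -> cube (x + d) -> 0 <= t <= 1 -> cube (x + t *: d).
Proof. exact: convex_set_segment convex_cube. Qed.

Lemma dotv_cubeB x y : cube x -> cube y -> dotv (x - y) (x - y) <= n%:R.
Proof.
move=> cx cy; apply: (@le_trans _ _ (\sum_(i < n) 1)).
  by apply: ler_sum => i _; rewrite !mxE; have := cx i; have := cy i; nra.
by rewrite sumr_const card_ord.
Qed.

Lemma is_gradient_line F x d g t : is_gradient F (x + t *: d) g ->
  is_derive_within [set s | cube (x + s *: d)] (fun s => F (x + s *: d)) t (dotv g d).
Proof.
have [->|d_neq0] := eqVneq d 0.
  rewrite /is_derive_within dotv0r => _.
  under eq_fun do rewrite !scaler0 subrr mul0r.
  exact: cvg_cst.
set A := [set s | _]; set p := x + t *: d => dF.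
have line_cvg : x + s *: d @[s --> within A t^'] --> within (@cube R n) p^'.
  apply: cvg_to_within; last exact: near_withinT.
  by apply: cvg_within_filter; exact: cvg_line_dnbhs.
pose remainder y := (F y - F p - dotv g (y - p)) / norm2 (y - p).
have : norm2 d * `|remainder (x + s *: d)| @[s --> within A t^'] --> (0 : R).
  rewrite -(mulr0 (norm2 d)) -(normr0 R); apply: cvgM; first exact: cvg_cst.
  exact: cvg_norm (cvg_comp _ _ line_cvg dF).
move=> remainder_cvg; apply/subr_cvg0; apply: norm_cvg0.
move: remainder_cvg; apply: cvg_trans; apply: near_eq_cvg.
rewrite near_withinE; near=> s => _.
have s_neq_t : s - t != 0 by rewrite subr_eq0; near: s; exact: nbhs_dnbhs_neq.
have norm2d_gt0 : 0 < norm2 d by rewrite norm2_gt0.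
have -> : (F (x + s *: d) - F p) / (s - t) - dotv g d =
    (F (x + s *: d) - F p - (s - t) * dotv g d) / (s - t) by field.
rewrite /remainder lineB norm2Z dotvZr !normf_div normrM normr_id.
rewrite (gtr0_norm norm2d_gt0).
by field; rewrite normr_eq0 s_neq_t gt_eqF.
Unshelve. all: by end_near. Qed.

End UnitCube.

Lemma smooth_on_quadratic_lower_bound (R : realType) n (P : set 'rV[R]_n)
    (F : 'rV[R]_n -> R) gradF (L : R) (x d : 'rV[R]_n) :
  P `<=` @cube R n -> convex_set P ->
  gradient_on_cube F gradF -> smooth_on P gradF L -> P x -> P (x + d) ->
  F x + dotv (gradF x) d - L * dotv d d / 2 <= F (x + d).
Proof.
move=> P_cube P_convex dF gradF_lip Px Pxd.
have P_line t : t \in `[0, 1] -> P (x + t *: d).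
  by rewrite in_itv; exact: convex_set_segment.
have := @is_derive_within_quadratic_ge R (fun t => F (x + t *: d))
  (fun t => dotv (gradF (x + t *: d)) d) 0 1 (dotv (gradF x) d) (L * dotv d d) ltr01.
rewrite scale0r addr0 scale1r subr0 mulr1 expr1n mulr1.
apply=> t t01.
  apply: is_derive_withinS (is_gradient_line (dF _ (P_cube _ (P_line t t01)))).
  by move=> s /P_line /P_cube.
rewrite subr0; have t_gt0 : 0 < t by move: t01; rewrite in_itv /= => /andP[].
have gradB_le : norm2 (gradF (x + t *: d) - gradF x) <= L * (t * norm2 d).
  have := gradF_lip _ _ (P_line t (subset_itv_oo_cc t01)) Px.
  by rewrite addrAC subrr add0r norm2Z gtr0_norm.
have /ler_normlP[+ _] := CauchySchwarz_norm2 (gradF (x + t *: d) - gradF x) d.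
have := ler_wpM2r (norm2_ge0 d) gradB_le; rewrite dotvBl -sqr_norm2; lra.
Qed.

Section DRSubmodular.
Variables (R : realType) (n : nat).
Implicit Types (x y d g : 'rV[R]_n) (s t u : R).
Variable F : 'rV[R]_n -> R.
Hypothesis F_DR : DR_submodular F.

Lemma DR_submodular_increment x y d :
  lerv x y -> lerv 0 d -> cube x -> cube (y + d) ->
  F (y + d) - F y <= F (x + d) - F x.
Proof.
move=> xy d_ge0 cx cyd.
pose path z k := F (z + prefixv k d).
have path_increment z : F (z + d) - F z = \sum_(0 <= k < n) (path z k.+1 - path z k).
  by rewrite telescope_sumr // /path prefixv0 prefixv_id addr0.
have cube_path z k : lerv x z -> lerv z y -> cube (z + prefixv k d).
  move=> xz zy; apply: cube_between cx cyd _ _.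
    exact: lerv_trans xz (lervDl z (prefixv_ge0 k d_ge0)).
  exact: lerv_trans (lerv_add2l z (prefixv_le k d_ge0)) (lerv_add2r d zy).
rewrite !path_increment; apply: ler_sum_nat => k /andP[_ kn].
have := d_ge0 (Ordinal kn); rewrite mxE le_eqVlt => /predU1P[d0|d_gt0].
  by rewrite /path (prefixvS (Ordinal kn)) -d0 scale0r addr0 !subrr.
have pathS z : path z k.+1 =
    F (z + prefixv k d + d 0 (Ordinal kn) *: delta_mx 0 (Ordinal kn)).
  by rewrite /path (prefixvS (Ordinal kn)) addrA.
rewrite !pathS; apply: F_DR => //; first exact: lerv_add2r.
all: by rewrite -?addrA -?(prefixvS (Ordinal kn)); exact: cube_path.
Qed.

Lemma DR_submodular_line_increment x d u s :
  same_sign d -> cube x -> cube (x + d) -> 0 <= u -> 0 <= s -> u + s <= 1 ->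
  F (x + (u + s) *: d) - F (x + u *: d) <= F (x + s *: d) - F x.
Proof.
move=> d_sign cx cxd u_ge0 s_ge0 us_le1.
have cus : cube (x + (u + s) *: d) by apply: cube_segment => //; rewrite addr_ge0.
case: d_sign => [d_ge0|/oppv_ge0 Nd_ge0].
  rewrite scalerDl addrA in cus *.
  exact: DR_submodular_increment (lervDl x (scalev_ge0 u_ge0 d_ge0))
    (scalev_ge0 s_ge0 d_ge0) cx cus.
(* Here the increment - s d is added to x + (u + s) d <= x + s d. *)
have := DR_submodular_increment (lervDl _ (scalev_ge0 u_ge0 Nd_ge0))
    (scalev_ge0 s_ge0 Nd_ge0) cus.
by rewrite !scalerN scalerDl addrA addrK addrAC !addrK => /(_ cx); lra.
Qed.

Lemma DR_submodular_tangent x d g :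
  same_sign d -> is_gradient F x g -> cube x -> cube (x + d) ->
  F (x + d) - F x <= dotv g d.
Proof.
move=> d_sign dF cx cxd.
have := @subadditive_increment_le_derive R (fun s => F (x + s *: d)) (dotv g d).
rewrite scale0r addr0 scale1r; apply.
  by move=> u s; exact: DR_submodular_line_increment.
apply: (@is_derive_withinS _ _ [set s | cube (x + s *: d)]).
  by move=> s; rewrite /= in_itv /= => s01; exact: cube_segment.
by apply: is_gradient_line; rewrite scale0r addr0.
Qed.

Variable gradF : 'rV[R]_n -> 'rV[R]_n.
Hypothesis dF : gradient_on_cube F gradF.

Lemma DR_submodular_concave x d t :
  same_sign d -> cube x -> cube (x + d) -> 0 <= t <= 1 ->
  (1 - t) * F x + t * F (x + d) <= F (x + t *: d).
Proof.
move=> d_sign cx cxd t01; have /andP[t_ge0 t_le1] := t01.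
have cz := cube_segment cx cxd t01; set z := x + t *: d in cz *.
have xE : x = z + - t *: d by rewrite scaleNr addrK.
have xdE : x + d = z + (1 - t) *: d by rewrite -addrA -scalerDl subrKC scale1r.
have := DR_submodular_tangent (same_signZ (- t) d_sign) (dF cz) cz; rewrite -xE.
have := DR_submodular_tangent (same_signZ (1 - t) d_sign) (dF cz) cz; rewrite -xdE.
rewrite !dotvZr => /(_ cxd)/(ler_wpM2l t_ge0) upper /(_ cx) lower.
have t'_ge0 : 0 <= 1 - t by rewrite subr_ge0.
have := ler_wpM2l t'_ge0 lower; lra.
Qed.

Lemma DR_submodular_gap x y : cube x -> cube y ->
  F (joinv x y) + F (meetv x y) - 2 * F x <= dotv (gradF x) (y - x).
Proof.
move=> cx cy.
have join_sign : same_sign (joinv x y - x).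
  by left; rewrite -(subrr x); exact/lerv_add2r/lerv_joinl.
have meet_sign : same_sign (meetv x y - x).
  by right; rewrite -(subrr x); exact/lerv_add2r/lerv_meetl.
have := DR_submodular_tangent join_sign (dF cx) cx; rewrite subrKC.
have := DR_submodular_tangent meet_sign (dF cx) cx; rewrite subrKC.
move=> /(_ (cube_meetv cx cy)) meet_tangent /(_ (cube_joinv cx cy)) join_tangent.
have -> : y - x = (joinv x y - x) + (meetv x y - x).
  by rewrite addrACA joinv_addr_meetv addrACA subrr add0r.
rewrite dotvDr; lra.
Qed.

Hypothesis F_ge0 : forall x, cube x -> 0 <= F x.

Lemma DR_submodular_joinv_ge x y t : cube x -> cube y ->
  0 <= t <= 1 -> (forall i, x 0 i <= t) -> (1 - t) * F y <= F (joinv x y).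
Proof.
move=> cx cy t01 x_le; have /andP[t_ge0 _] := t01.
have [t0|t_neq0] := eqVneq t 0.
  rewrite t0 subr0 mul1r (_ : joinv x y = y) //; apply/rowP => i.
  have /andP[y_ge0 _] := cy i; rewrite mxE; apply/max_idPr.
  by rewrite (le_trans (x_le i)) ?t0.
have t_gt0 : 0 < t by rewrite lt0r t_neq0.
pose d := t^-1 *: (joinv x y - y).
have d_ge0 : lerv 0 d.
  by apply: scalev_ge0; rewrite ?invr_ge0 // -(subrr y); exact/lerv_add2r/lerv_joinr.
have joinE : y + t *: d = joinv x y by rewrite scalerA divff ?scale1r ?subrKC.
have cyd : cube (y + d).
  move=> i; have /andP[y_ge0 y_le1] := cy i; have := d_ge0 i.
  rewrite [X in X <= _]mxE [X in _ <= X <= _]mxE => di_ge0; rewrite addr_ge0 //=.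
  rewrite -lerBrDl !mxE ler_pdivrMl // lerBlDr ge_max.
  by have := x_le i; nra.
have := DR_submodular_concave (or_introl d_ge0) cy cyd t01; rewrite joinE.
by apply: le_trans; rewrite lerDl mulr_ge0 ?F_ge0.
Qed.

End DRSubmodular.

(* Weighting the two lower bounds on G by a and b - a avoids a case distinction on
   the sign of fstar / a - 2 f. *)
Lemma weighted_gap_ge (R : realFieldType) (a b f fstar G : R) :
  0 < a -> a <= b -> 0 <= f -> 0 <= G -> fstar / a - 2 * f <= G ->
  fstar <= (a + b) * f + b * G.
Proof.
move=> a_gt0 ab f_ge0 G_ge0 /(ler_wpM2l (ltW a_gt0)).
rewrite mulrBr mulrCA divff ?gt_eqF // mulr1 => gap_ge.
have : 0 <= (b - a) * (f + G) by rewrite mulr_ge0 ?subr_ge0 // addr_ge0.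
lra.
Qed.

Section WeightedFrankWolfe.
Variables (R : realType) (n : nat).

Definition weighted_FW_run (gradF : 'rV[R]_n -> 'rV[R]_n) (P : set 'rV[R]_n)
    (a : nat -> R) (T : nat) (x : nat -> 'rV[R]_n) : Prop :=
  x 0%N = 0 /\
  forall j, (j < T)%N ->
    exists2 v, is_argmax P (dotv (gradF (x j))) v &
      x j.+1 = (a j / a j.+1) *: x j + (1 - a j / a j.+1) *: v.

Variables (P : set 'rV[R]_n) (F : 'rV[R]_n -> R) (gradF : 'rV[R]_n -> 'rV[R]_n).
Variables (L : R) (a : nat -> R) (T : nat) (x : nat -> 'rV[R]_n).
Hypotheses (P_cube : P `<=` @cube R n) (P_convex : convex_set P) (P_0 : P 0).
Hypotheses (F_ge0 : forall y, cube y -> 0 <= F y) (dF : gradient_on_cube F gradF).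
Hypotheses (F_DR : DR_submodular F) (L_ge0 : 0 <= L) (gradF_lip : smooth_on P gradF L).
Hypotheses (a_0 : a 0 = 1) (a_ndecr : nondecreasing_seq a).
Hypothesis x_run : weighted_FW_run gradF P a T x.

Lemma weight_ge1 j : 1 <= a j.
Proof. by rewrite -a_0 a_ndecr. Qed.

Lemma weight_gt0 j : 0 < a j.
Proof. exact: lt_le_trans ltr01 (weight_ge1 j). Qed.

Local Notation step j := (1 - a j / a j.+1).

Lemma step_size_itv01 j : 0 <= step j <= 1.
Proof.
rewrite subr_ge0 gerBl ler_pdivrMr ?weight_gt0 // mul1r a_ndecr //=.
by rewrite divr_ge0 // ltW ?weight_gt0.
Qed.

Lemma weighted_FW_step j : (j < T)%N ->
  exists2 v, is_argmax P (dotv (gradF (x j))) v &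
    x j.+1 = x j + step j *: (v - x j).
Proof.
move=> jT; have [v v_max ->] := x_run.2 j jT; exists v => //.
by apply/rowP => i; rewrite !mxE; ring.
Qed.

Lemma weighted_FW_feasible j : (j <= T)%N -> P (x j).
Proof.
elim: j => [_|j IH jT]; first by rewrite x_run.1.
have [v [Pv _] ->] := weighted_FW_step jT.
by apply: convex_set_segment (step_size_itv01 j); rewrite ?subrKC //; exact/IH/ltnW.
Qed.

Lemma weighted_FW_coord_le j i : (j <= T)%N -> x j 0 i <= 1 - (a j)^-1.
Proof.
elim: j => [_|j IH jT]; first by rewrite x_run.1 a_0 invr1 subrr mxE.
have [v [/P_cube v_cube _] ->] := x_run.2 j jT.
have /andP[_ v_le1] := v_cube i; have /andP[step_ge0 _] := step_size_itv01 j.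
have decay_ge0 : 0 <= a j / a j.+1 by rewrite divr_ge0 // ltW ?weight_gt0.
have decayE : a j / a j.+1 * (1 - (a j)^-1) = a j / a j.+1 - (a j.+1)^-1.
  by field; rewrite !gt_eqF ?weight_gt0.
have := ler_wpM2l decay_ge0 (IH (ltnW jT)); rewrite decayE !mxE.
have := ler_wpM2l step_ge0 v_le1; lra.
Qed.

Lemma weighted_FW_gap j y v : (j <= T)%N -> P y ->
  is_argmax P (dotv (gradF (x j))) v ->
  F y / a j - 2 * F (x j) <= dotv (gradF (x j)) (v - x j).
Proof.
move=> jT Py [_ /(_ y Py) y_le_v].
have x_cube := P_cube (weighted_FW_feasible jT); have y_cube := P_cube Py.
have meet_ge0 : 0 <= F (meetv (x j) y) by exact/F_ge0/cube_meetv.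
have join_ge : F y / a j <= F (joinv (x j) y).
  have a'_itv : 0 <= 1 - (a j)^-1 <= 1.
    rewrite subr_ge0 gerBl invr_ge0 invf_le1 ?weight_gt0 // weight_ge1 /=.
    by rewrite ltW ?weight_gt0.
  have := DR_submodular_joinv_ge F_DR dF F_ge0 x_cube y_cube a'_itv.
  by rewrite subKr mulrC; apply=> i; exact: weighted_FW_coord_le.
have := DR_submodular_gap F_DR dF x_cube y_cube.
rewrite !dotvBr; lra.
Qed.

Lemma weighted_FW_ascent j v : (j < T)%N -> P v -> x j.+1 = x j + step j *: (v - x j) ->
  F (x j) + step j * dotv (gradF (x j)) (v - x j) - n%:R * L / 2 * step j ^+ 2 <=
    F (x j.+1).
Proof.
move=> jT Pv xS.
have Px := weighted_FW_feasible (ltnW jT); have PxS := weighted_FW_feasible jT.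
rewrite xS in PxS *.
apply: le_trans (smooth_on_quadratic_lower_bound P_cube P_convex dF gradF_lip Px PxS).
have := dotv_cubeB (P_cube Pv) (P_cube Px).
have coef_ge0 : 0 <= L / 2 * step j ^+ 2 by rewrite mulr_ge0 ?sqr_ge0 ?divr_ge0.
move=> /(ler_wpM2l coef_ge0); rewrite !dotvZr dotvZl; lra.
Qed.

Lemma weighted_FW_potential_step j y : (j < T)%N -> P y ->
  (a j.+1 - a j) * F y - n%:R * L / 2 * (a j.+1 - a j) ^+ 2 <=
    a j.+1 ^+ 2 * F (x j.+1) - a j ^+ 2 * F (x j).
Proof.
move=> jT Py; have [v v_max xS] := weighted_FW_step jT.
have Pv := v_max.1; have x_cube := P_cube (weighted_FW_feasible (ltnW jT)).
have gap := weighted_FW_gap (ltnW jT) Py v_max.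
have gap_ge0 : 0 <= dotv (gradF (x j)) (v - x j).
  by rewrite dotvBr subr_ge0 v_max.2 //; exact/weighted_FW_feasible/ltnW.
have ab_ge0 : 0 <= a j.+1 - a j by rewrite subr_ge0 a_ndecr.
have := weighted_gap_ge (weight_gt0 j) (a_ndecr (leqnSn j)) (F_ge0 x_cube) gap_ge0 gap.
move=> /(ler_wpM2l ab_ge0).
have := ler_wpM2l (sqr_ge0 (a j.+1)) (weighted_FW_ascent jT Pv xS).
set G := dotv _ _.
have -> : a j.+1 ^+ 2 * (F (x j) + step j * G - n%:R * L / 2 * step j ^+ 2) =
    a j.+1 ^+ 2 * F (x j) + a j.+1 * (a j.+1 - a j) * G -
    n%:R * L / 2 * (a j.+1 - a j) ^+ 2.
  by field; rewrite gt_eqF ?weight_gt0.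
lra.
Qed.

Lemma weighted_FW_potential y : P y ->
  (a T - 1) * F y - n%:R * L / 2 * \sum_(0 <= j < T) (a j.+1 - a j) ^+ 2 <=
    a T ^+ 2 * F (x T).
Proof.
move=> Py.
have telescoped : \sum_(0 <= j < T) ((a j.+1 - a j) * F y -
      n%:R * L / 2 * (a j.+1 - a j) ^+ 2) <=
    \sum_(0 <= j < T) (a j.+1 ^+ 2 * F (x j.+1) - a j ^+ 2 * F (x j)).
  by apply: ler_sum_nat => j /andP[_ jT]; exact: weighted_FW_potential_step.
move: telescoped.
rewrite sumrB -mulr_suml -mulr_sumr telescope_sumr //.
rewrite (telescope_sumr (fun j => a j ^+ 2 * F (x j))) // a_0 => /le_trans; apply.
rewrite gerBl mulr_ge0 ?sqr_ge0 ?F_ge0 // x_run.1; exact: P_cube.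
Qed.

End WeightedFrankWolfe.

Section HarmonicNumber.
Variable R : realType.
Implicit Types (j T : nat).

Lemma harmonic_number0 : harmonic_number R 0 = 0.
Proof. by rewrite /harmonic_number big_geq. Qed.

Lemma harmonic_numberS j : harmonic_number R j.+1 = harmonic_number R j + j.+1%:R^-1.
Proof. by rewrite /harmonic_number big_nat_recr. Qed.

Lemma harmonic_number_ge0 j : 0 <= harmonic_number R j.
Proof. by apply: sumr_ge0 => k _; rewrite invr_ge0. Qed.

Lemma harmonic_number_gt0 j : (0 < j)%N -> 0 < harmonic_number R j.
Proof.
by case: j => // j _; rewrite harmonic_numberS ltr_wpDl ?harmonic_number_ge0 ?invr_gt0.
Qed.

Lemma lnS_le_harmonic_number j : ln j.+1%:R <= harmonic_number R j.
Proof.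
elim: j => [|j IH]; first by rewrite ln1 harmonic_number_ge0.
have inv_gt0 : 0 < j.+1%:R^-1 :> R by rewrite invr_gt0.
have -> : j.+2%:R = j.+1%:R * (1 + j.+1%:R^-1) :> R.
  by rewrite mulrDr mulr1 divff ?pnatr_eq0 // natr1.
rewrite lnM ?posrE ?addr_gt0 // harmonic_numberS lerD // le_ln1Dx //.
exact: lt_trans (ltrN10 R) inv_gt0.
Qed.

Lemma ln_le_harmonic_number j : (0 < j)%N -> ln j%:R <= harmonic_number R j.
Proof.
move=> j_gt0; apply: le_trans (lnS_le_harmonic_number j).
by rewrite ler_ln ?posrE ?ltr0n // ler_nat.
Qed.

Lemma sum_inv_sqr_le j :
  \sum_(0 <= i < j.+1) i.+1%:R^-1 ^+ 2 <= 2 - j.+1%:R^-1 :> R.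
Proof.
elim: j => [|j IH]; first by rewrite big_nat1 invr1 expr1n; lra.
rewrite big_nat_recr //=.
suff : j.+2%:R^-1 ^+ 2 <= j.+1%:R^-1 - j.+2%:R^-1 :> R.
  by move=> /(lerD IH); rewrite addrA subrK.
have j1_gt0 : 0 < j.+1%:R :> R by rewrite ltr0n.
have j2_gt0 : 0 < j.+2%:R :> R by rewrite ltr0n.
have -> : j.+1%:R^-1 - j.+2%:R^-1 = (j.+1%:R * j.+2%:R)^-1 :> R.
  rewrite -[j.+2%:R]natr1 in j2_gt0 *.
  by field; rewrite !gt_eqF.
by rewrite exprVn lef_pV2 ?posrE ?exprn_gt0 ?mulr_gt0 // expr2 ler_pM2r // ler_nat.
Qed.

Definition fw_weight T j : R := 1 + harmonic_number R j / harmonic_number R T.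

Lemma fw_weight0 T : fw_weight T 0 = 1.
Proof. by rewrite /fw_weight harmonic_number0 mul0r addr0. Qed.

Lemma fw_weightT T : (0 < T)%N -> fw_weight T T = 2.
Proof. by move=> T_gt0; rewrite /fw_weight divff // gt_eqF ?harmonic_number_gt0. Qed.

Lemma fw_weight_gt0 T j : 0 < fw_weight T j.
Proof. by rewrite ltr_wpDr // divr_ge0 ?harmonic_number_ge0. Qed.

Lemma fw_weightSB T j :
  fw_weight T j.+1 - fw_weight T j = j.+1%:R^-1 / harmonic_number R T.
Proof. by rewrite /fw_weight harmonic_numberS; ring. Qed.

Lemma nondecreasing_fw_weight T : nondecreasing_seq (fw_weight T).
Proof.
apply/nondecreasing_seqP => j.
by rewrite -subr_ge0 fw_weightSB divr_ge0 ?harmonic_number_ge0 ?invr_ge0.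
Qed.

Lemma sum_sqr_fw_weightSB_le T : (0 < T)%N ->
  \sum_(0 <= j < T) (fw_weight T j.+1 - fw_weight T j) ^+ 2 <=
    2 / harmonic_number R T ^+ 2.
Proof.
case: T => // T _; under eq_bigr do rewrite fw_weightSB exprMn.
rewrite -mulr_suml -exprVn ler_wpM2r ?sqr_ge0 //.
by rewrite (le_trans (sum_inv_sqr_le T)) // gerBl invr_ge0.
Qed.

Lemma fw_decayE T j : fw_decay R T j = fw_weight T j / fw_weight T j.+1.
Proof.
rewrite /fw_decay /fw_time ![1 + (_^-1 - 1)]subrKC !invrK.
rewrite -!/(fw_weight _ _) opprB addrA subrK expRD expRN.
by rewrite !lnK ?posrE ?fw_weight_gt0.
Qed.

End HarmonicNumber.

Section FWDis.
Variables (R : realType) (n : nat) (P : set 'rV[R]_n) (F : 'rV[R]_n -> R).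
Variables (gradF : 'rV[R]_n -> 'rV[R]_n) (L : R) (y : 'rV[R]_n).
Hypotheses (P_cube : P `<=` @cube R n) (P_convex : convex_set P) (P_0 : P 0).
Hypotheses (F_ge0 : forall z, cube z -> 0 <= F z) (dF : gradient_on_cube F gradF).
Hypotheses (F_DR : DR_submodular F) (L_ge0 : 0 <= L) (gradF_lip : smooth_on P gradF L).
Hypothesis P_y : P y.
Implicit Types (T : nat) (x : nat -> 'rV[R]_n) (eps : R).

Lemma FW_Dis_run_weighted T x :
  FW_Dis_run gradF P T x -> weighted_FW_run gradF P (fw_weight R T) T x.
Proof.
move=> [x0 x_step]; split=> // j /x_step[v v_max xS].
by exists v => //; rewrite xS fw_decayE.
Qed.

Lemma FW_Dis_harmonic_bound T x : (0 < T)%N -> FW_Dis_run gradF P T x ->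
  1 / 4 * F y - 1 / 4 * (n%:R * L / harmonic_number R T ^+ 2) <= F (x T).
Proof.
move=> T_gt0 /FW_Dis_run_weighted x_run.
have := weighted_FW_potential P_cube P_convex P_0 F_ge0 dF F_DR L_ge0 gradF_lip
  (fw_weight0 R T) (@nondecreasing_fw_weight R T) x_run P_y.
have coef_ge0 : 0 <= n%:R * L / 2 by rewrite !mulr_ge0.
have := ler_wpM2l coef_ge0 (sum_sqr_fw_weightSB_le R T_gt0).
rewrite fw_weightT //; lra.
Qed.

Lemma FW_Dis_ln_bound T x : (2 <= T)%N -> FW_Dis_run gradF P T x ->
  1 / 4 * F y - 1 / 4 * (n%:R * L / ln T%:R ^+ 2) <= F (x T).
Proof.
move=> T_ge2 x_run; have T_gt0 : (0 < T)%N := ltnW T_ge2.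
apply: le_trans (FW_Dis_harmonic_bound T_gt0 x_run).
have lnT_gt0 : 0 < ln T%:R :> R by rewrite ln_gt0 // ltr1n.
rewrite lerD2l lerN2 ler_wpM2l // ler_wpM2l ?mulr_ge0 //.
rewrite lef_pV2 ?posrE ?exprn_gt0 ?harmonic_number_gt0 //.
by rewrite lerXn2r ?nnegrE ?harmonic_number_ge0 ?(ltW lnT_gt0) ?ln_le_harmonic_number.
Qed.

Lemma FW_Dis_eps_bound T x eps : 0 < eps ->
  expR (Num.sqrt (n%:R * L / eps)) <= T%:R -> FW_Dis_run gradF P T x ->
  1 / 4 * F y - eps <= F (x T).
Proof.
move=> eps_gt0; set s := Num.sqrt _ => T_ge x_run.
have T_gt0 : (0 < T)%N by rewrite -(ltr0n R) (lt_le_trans (expR_gt0 s)).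
apply: le_trans (FW_Dis_harmonic_bound T_gt0 x_run).
have harmonic_T_gt0 := harmonic_number_gt0 R T_gt0.
have s_le : s <= harmonic_number R T.
  apply: le_trans (ln_le_harmonic_number R T_gt0).
  by rewrite -[s]expRK ler_ln ?posrE ?expR_gt0 ?ltr0n.
suff error_le : n%:R * L / harmonic_number R T ^+ 2 <= eps by lra.
have nL_ge0 : 0 <= n%:R * L / eps by rewrite divr_ge0 ?mulr_ge0 // ltW.
rewrite ler_pdivrMr ?exprn_gt0 // -ler_pdivrMl // mulrC -(sqr_sqrtr nL_ge0).
by rewrite lerXn2r ?nnegrE ?sqrtr_ge0 ?(ltW harmonic_T_gt0).
Qed.

End FWDis.

Theorem theorem1 (R : realType) :
  exists C1 C2 : R, 0 < C1 /\ 0 < C2 /\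
  forall (n : nat) (P : set 'rV[R]_n) (F : 'rV[R]_n -> R)
    (gradF : 'rV[R]_n -> 'rV[R]_n) (L : R) (xstar : 'rV[R]_n),
  (1 <= n)%N ->
  P `<=` @cube R n -> convex_set P -> P 0 ->
  (forall x, cube x -> 0 <= F x) ->
  gradient_on_cube F gradF ->
  DR_submodular F ->
  F 0 = 0 ->
  0 <= L -> smooth_on P gradF L ->
  is_argmax P F xstar ->
  (forall (T : nat) (x : nat -> 'rV[R]_n), (2 <= T)%N ->
     FW_Dis_run gradF P T x ->
     F (x T) >= 1 / 4 * F xstar - C1 * (n%:R * L / ln T%:R ^+ 2)) /\
  (forall eps : R, 0 < eps ->
     exists N : nat, [/\ (1 <= N)%N,
       N%:R <= C2 * expR (Num.sqrt (n%:R * L / eps)) &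
       forall (T : nat) (x : nat -> 'rV[R]_n), (N <= T)%N ->
         FW_Dis_run gradF P T x ->
         F (x T) >= 1 / 4 * F xstar - eps]).
Proof.
exists (1 / 4), 2; split; [by lra | split; [by [] |]].
move=> n P F gradF L xstar _ P_cube P_convex P_0 F_ge0 dF F_DR _ L_ge0 gradF_lip.
move=> [P_xstar _].
split=> [T x|eps eps_gt0]; first exact: FW_Dis_ln_bound.
set s := Num.sqrt _; have /andP[trunc_le trunc_gt] := truncn_itv (expR_ge0 s).
exists (Num.truncn (expR s)).+1; split=> [//||T x T_ge].
  have expR_ge1 : 1 <= expR s by rewrite -expR0 ler_expR sqrtr_ge0.
  by rewrite -natr1; lra.
apply: (@FW_Dis_eps_bound _ _ _ _ gradF L) => //.
by rewrite (le_trans (ltW trunc_gt)) // ler_nat.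
Qed.
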